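(* Let $\mathcal A_+=\{a_1,\dots,a_k\},\ \mathcal A_-=\{b_1,\dots,b_m\}\subseteq\mathbb Z^n$ be disjoint nonempty finite sets with $\mathcal A=\mathcal A_+\cup\mathcal A_-$ full dimensional and $(\mathcal A_+,\mathcal A_-)$ nonseparable. Let $F$ be its critical system, $h:\mathcal A\to\mathbb Z$ a height function lifting $\mathcal A_-$, and $f\in\mathcal S(\mathcal A_+,\mathcal A_-)$ with nonsigned coefficients $c\in\mathbb R^{\mathcal A}_{>0}$. Let $\lambda_1,\dots,\lambda_k>0$ with $\sum_i\lambda_i=1$ and $\sum_i\lambda_ia_i=b_1$, and define $\hat c\in\mathbb R^{\mathcal A}_{\ge0}$ by $\hat c_{a_i}=\lambda_i$, $\hat c_{b_1}=1$, $\hat c_{b_j}=0$ for $j\ge2$. Let $H(s,(t,x))=F((sc+(1-s)\hat c)\star t^h,x)$ for $s\in[0,1]$. Then $H(0,(1,\mathbb 1))=0$, and there is a unique continuous path $s\mapsto(t(s),x(s))\in\mathbb R^{n+1}_{>0}$, $s\in[0,1]$, with $(t(0),x(0))=(1,\mathbb 1)$ and $H(s,(t(s),x(s)))=0$ for all $s$; its endpoint $(t_*,x_* )=(t(1),x(1))$ satisfies $S=\{t_*\}$, where $S=\{t\in\mathbb R_{>0}:F(c\star t^h,x)=0\text{ for some }x\in\mathbb R^n_{>0}\}$.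
   Context: For a coefficient vector $c\in\mathbb R^{\mathcal A}$, $f_c(x)=\sum_{a\in\mathcal A_+}c_ax^a-\sum_{b\in\mathcal A_-}c_bx^b$; $\mathcal S(\mathcal A_+,\mathcal A_-)$ is the set of these with $c\in\mathbb R^{\mathcal A}_{>0}$ (nonsigned coefficients). The critical system is $F(c,x)=(f_c(x),x_1\partial_{x_1}f_c(x),\dots,x_n\partial_{x_n}f_c(x))$. Full dimensional: $\dim\operatorname{conv}(\mathcal A)=n$. $\mathcal F(\mathcal A_+)$ is the common refinement of all regular polyhedral subdivisions of $\mathcal A_+$, $\mathcal F_n(\mathcal A_+)$ its $n$-cells; $(\mathcal A_+,\mathcal A_-)$ is nonseparable if $\mathcal A_-\subseteq\operatorname{relint}\operatorname{conv}(\mathcal A_+)$ and some $D\in\mathcal F_n(\mathcal A_+)$ contains $\mathcal A_-$. A height function $h$ lifts $\mathcal A_-$ if $h(a)>0$ for $a\in\mathcal A_-$ and $h(a)=0$ for $a\in\mathcal A_+$; $c\star t^h=(c_at^{h(a)})_a$; $\mathbb 1=(1,\dots,1)$. *)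

(* Defs.v *)
From HB Require Import structures.
From mathcomp Require Import all_boot all_order all_algebra.
From mathcomp Require Import all_classical all_reals all_analysis.
Set Implicit Arguments. Unset Strict Implicit. Unset Printing Implicit Defensive.
Import Order.TTheory GRing.Theory Num.Theory.
Import numFieldNormedType.Exports.
Local Open Scope classical_set_scope.
Local Open Scope ring_scope.

Section Defs.
Variables (R : realType) (n : nat).

Definition pt (a : 'rV[int]_n) : 'rV[R]_n := map_mx (fun z : int => z%:~R) a.

Definition monom (x : 'rV[R]_n) (a : 'rV[int]_n) : R :=
  \prod_(l < n) (x ord0 l) ^ (a ord0 l).

Definition fpoly (k m : nat) (a : 'I_k -> 'rV[int]_n) (b : 'I_m -> 'rV[int]_n)
  (cp : 'I_k -> R) (cm : 'I_m -> R) (x : 'rV[R]_n) : R :=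
  \sum_(i < k) cp i * monom x (a i) - \sum_(j < m) cm j * monom x (b j).

Definition crit (k m : nat) (a : 'I_k -> 'rV[int]_n) (b : 'I_m -> 'rV[int]_n)
  (cp : 'I_k -> R) (cm : 'I_m -> R) (x : 'rV[R]_n) : 'rV[R]_(n.+1) :=
  \row_(r < n.+1)
    match unlift ord0 r with
    | None => fpoly a b cp cm x
    | Some l => x ord0 l * derive (fpoly a b cp cm) x (delta_mx ord0 l)
    end.

Definition cstar (I : Type) (c : I -> R) (h : I -> int) (t : R) : I -> R :=
  fun i => c i * t ^ (h i).

Definition cvx_hull (I : finType) (p : I -> 'rV[R]_n) (P : pred I) : set 'rV[R]_n :=
  [set y | exists mu : I -> R, (forall i, 0 <= mu i) /\ (forall i, ~~ P i -> mu i = 0)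
      /\ \sum_i mu i = 1 /\ y = \sum_i mu i *: p i].

Definition aff_hull (X : set 'rV[R]_n) : set 'rV[R]_n :=
  [set y | exists (s : seq 'rV[R]_n) (mu : 'I_(size s) -> R),
      (forall v, v \in s -> X v) /\ \sum_i mu i = 1 /\ y = \sum_i mu i *: s`_i].

Definition relint (X : set 'rV[R]_n) : set 'rV[R]_n :=
  [set y | X y /\ exists2 e : R, 0 < e & forall z, aff_hull X z -> ball y e z -> X z].

Definition full_dim (X : set 'rV[R]_n) : Prop :=
  exists (x0 : 'rV[R]_n) (vs : 'I_n -> 'rV[R]_n),
    X x0 /\ (forall i, X (x0 + vs i)) /\ row_free (\matrix_(i < n) vs i).

Definition affn (L : 'rV[R]_n * R) (p : 'rV[R]_n) : R := (p *m L.1^T) ord0 ord0 + L.2.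

Definition allpts (k m : nat) (a : 'I_k -> 'rV[int]_n) (b : 'I_m -> 'rV[int]_n)
  : 'I_k + 'I_m -> 'rV[R]_n :=
  fun u => match u with inl i => pt (a i) | inr j => pt (b j) end.

(** (A+,A-) nonseparable: A- in relint cvx_hull(A+), and some n-cell D of the common
    refinement F(A+) of all regular subdivisions of A+ contains A-.
    A cell of the regular subdivision induced by heights w : A+ -> R is
    cvx_hull{a_i : l(a_i) = w_i} for an affine l with l(a_i) <= w_i for all i
    (a lower face of the lifted polytope); a cell of the common refinement is
    an intersection of one cell of each regular subdivision; an n-cell is an
    n-dimensional one. *)
Definition nonseparable (k m : nat) (a : 'I_k -> 'rV[int]_n) (b : 'I_m -> 'rV[int]_n)
  : Prop :=
  (forall j, relint (cvx_hull (fun i => pt (a i)) predT) (pt (b j))) /\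
  exists L : ('I_k -> R) -> 'rV[R]_n * R,
    (forall w i, affn (L w) (pt (a i)) <= w i) /\
    let D := [set y | forall w : 'I_k -> R,
                cvx_hull (fun i => pt (a i)) (fun i => affn (L w) (pt (a i)) == w i) y] in
    full_dim D /\ (forall j, D (pt (b j))).

Definition path_ok (H : R -> R -> 'rV[R]_n -> 'rV[R]_(n.+1))
  (t : R -> R) (x : R -> 'rV[R]_n) : Prop :=
  let I := [set s : R | 0 <= s <= 1] in
  {within I, continuous t} /\ {within I, continuous x} /\
  (forall s, I s -> 0 < t s /\ forall l, 0 < x s ord0 l) /\
  t 0 = 1 /\ x 0 = const_mx 1 /\
  (forall s, I s -> H s (t s) (x s) = 0).

End Defs.

(* Main.v *)
Require Import Defs.
From HB Require Import structures.
From mathcomp Require Import all_boot all_order all_algebra.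
From mathcomp Require Import all_classical all_reals all_analysis.
From mathcomp Require Import ring lra.
Import Order.TTheory GRing.Theory Num.Theory.
Import numFieldNormedType.Exports.
Local Open Scope classical_set_scope.
Local Open Scope ring_scope.

(* In logarithmic coordinates [x = exp u] the signomial is
     f_t(u) = sum_i A_i e^(a_i.u) - sum_j B_j t^(h_j) e^(b_j.u),
   which strictly decreases in [t].  If [u] is a critical zero of [f_t], then [f_t >= 0]
   everywhere, with no other zero: given [v], take the heights [w_i = e^(a_i.(v-u))] and
   the affine function [L <= w] that supports the cell containing all the [b_j];
   criticality at [u] gives sum_i A_i e^(a_i.u) L(a_i) = sum_j B_j t^(h_j) e^(b_j.u) L(b_j),
   while convexity of [exp] gives L(b_j) >= e^(b_j.(v-u)).  Hence [t] is the largest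
   parameter with [f_t >= 0], and the critical pair (t, u) is unique.  Conversely,
   minimising [t] over {(t, u) : f_t(u) <= 0}, which is compact near its minimum because
   the [b_j] are interior points of conv(A+), produces a critical zero.  As the bounds are
   uniform in the homotopy parameter [s], the critical pair has a closed graph in a compact
   set, so it depends continuously on [s]; it is the only possible path. *)

(** * Pairings, affine functions, and Jensen's inequality for the exponential with its equality
    case *)

Section DotProduct.
Set Implicit Arguments. Unset Strict Implicit.
Variables (R : realType) (n : nat).
Implicit Types (p u v : 'rV[R]_n).

Definition dotv p u : R := \sum_l p ord0 l * u ord0 l.

Lemma dotvBr p u v : dotv p (u - v) = dotv p u - dotv p v.
Proof. by rewrite -sumrB; apply: eq_bigr => l _; rewrite !mxE mulrBr. Qed.

Lemma dotvDl p q u : dotv (p + q) u = dotv p u + dotv q u.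
Proof. by rewrite -big_split; apply: eq_bigr => l _; rewrite mxE mulrDl. Qed.

Lemma dotv_suml (I : finType) (mu : I -> R) (p : I -> 'rV[R]_n) u :
  dotv (\sum_i mu i *: p i) u = \sum_i mu i * dotv (p i) u.
Proof.
under [RHS]eq_bigr do rewrite mulr_sumr.
rewrite exchange_big; apply: eq_bigr => l _.
by rewrite summxE mulr_suml; apply: eq_bigr => i _; rewrite mxE mulrA.
Qed.

Lemma dotv_delta (c : R) l u : dotv (c *: delta_mx ord0 l) u = c * u ord0 l.
Proof.
rewrite /dotv (bigD1 l) //= !mxE !eqxx mulr1 big1 ?addr0 // => j jl.
by rewrite !mxE (negPf jl) andbF mulr0 mul0r.
Qed.

Lemma affn_dotv (L : 'rV[R]_n * R) p : affn L p = dotv p L.1 + L.2.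
Proof. by rewrite /affn mxE; congr (_ + _); apply: eq_bigr => l _; rewrite mxE. Qed.

Lemma affn_barycenter (I : finType) (mu : I -> R) (p : I -> 'rV[R]_n) L :
  \sum_i mu i = 1 -> affn L (\sum_i mu i *: p i) = \sum_i mu i * affn L (p i).
Proof.
move=> mu1; under [RHS]eq_bigr do rewrite affn_dotv mulrDr.
by rewrite affn_dotv big_split /= -mulr_suml mu1 mul1r dotv_suml.
Qed.

Lemma ler_sum_eq (I : finType) (F G : I -> R) : (forall i, F i <= G i) ->
  \sum_i G i <= \sum_i F i -> forall i, F i = G i.
Proof.
move=> FG GF i; have gap0 r : true -> 0 <= G r - F r by rewrite subr_ge0.
have /(psumr_eq0P gap0) /(_ i isT) /eqP : \sum_r (G r - F r) = 0.
  by apply/eqP; rewrite sumrB subr_eq0 eq_le GF ler_sum.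
by rewrite subr_eq0 => /eqP.
Qed.

(** The excess of the exponential at [y] over its tangent line at [c]. *)
Definition tangent_gap (c y : R) : R := expR y - expR c * (1 + (y - c)).

Lemma tangent_gap_ge0 c y : 0 <= tangent_gap c y.
Proof.
rewrite subr_ge0 -[in leRHS](subrK c y) expRD [leRHS]mulrC.
by rewrite ler_wpM2l ?expR_ge0 ?expR_ge1Dx.
Qed.

Lemma tangent_gap_eq0 c y : tangent_gap c y = 0 -> y = c.
Proof.
move=> E; apply/eqP; rewrite -subr_eq0; apply: contraT => /expR_gt1Dx.
rewrite -(ltr_pM2l (expR_gt0 c)) -expRD subrKC => lt_y.
by move/eqP: E; rewrite subr_eq0 => /eqP E; rewrite -E ltxx in lt_y.
Qed.

(** With the tangent taken at the barycentre, the linear terms cancel. This is Jensen with its exact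
    defect, so the inequality and its equality case both follow from the sign of the gaps. *)
Lemma expR_barycenter (I : finType) (mu y : I -> R) : \sum_i mu i = 1 ->
  \sum_i mu i * expR (y i) = expR (\sum_i mu i * y i)
    + \sum_i mu i * tangent_gap (\sum_j mu j * y j) (y i).
Proof.
move=> mu1; set c := \sum_i mu i * y i.
under [X in _ + X]eq_bigr do rewrite mulrBr.
rewrite sumrB addrCA; apply/esym/eqP; rewrite -subr_eq0 addrAC subrr add0r.
under eq_bigr do rewrite mulrCA.
rewrite -mulr_sumr; under eq_bigr do rewrite mulrDr mulr1 mulrBr.
by rewrite big_split sumrB /= -mulr_suml mu1 mul1r -/c subrr addr0 mulr1 subrr.
Qed.

Lemma expR_barycenter_le (I : finType) (mu y : I -> R) :
  (forall i, 0 <= mu i) -> \sum_i mu i = 1 ->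
  expR (\sum_i mu i * y i) <= \sum_i mu i * expR (y i).
Proof.
move=> mu0 mu1; rewrite expR_barycenter // lerDl sumr_ge0 // => i _.
by rewrite mulr_ge0 ?tangent_gap_ge0.
Qed.

Lemma expR_barycenter_eq (I : finType) (mu y : I -> R) :
  (forall i, 0 < mu i) -> \sum_i mu i = 1 ->
  \sum_i mu i * expR (y i) <= expR (\sum_i mu i * y i) ->
  forall i, y i = \sum_i mu i * y i.
Proof.
move=> mu0 mu1; rewrite expR_barycenter // gerDl => le0 i.
have gap0 j : true -> 0 <= mu j * tangent_gap (\sum_j mu j * y j) (y j).
  by rewrite mulr_ge0 ?tangent_gap_ge0 // ltW.
have /(psumr_eq0P gap0) /(_ i isT) /eqP : 
    \sum_j mu j * tangent_gap (\sum_j mu j * y j) (y j) = 0.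
  by apply/eqP; rewrite eq_le le0 sumr_ge0.
by rewrite mulf_eq0 gt_eqF //= => /eqP /tangent_gap_eq0.
Qed.
End DotProduct.

(** A cluster value [y] of [g] at [x] within [D] satisfies [G (x, y)] by closedness, hence equals
    [g x]; inside a compact set, a filter with a single cluster point converges to it. *)
Lemma closed_graph_continuous (X Y : topologicalType) (D : set X) (V : set Y)
    (G : set (X * Y)) (g : X -> Y) :
  hausdorff_space Y -> compact V -> closed G ->
  (forall x, D x -> nbhs (g x) V) -> (forall x, D x -> G (x, g x)) ->
  (forall x y, D x -> G (x, y) -> y = g x) ->
  {within D, continuous g}.
Proof.
move=> hY cV cG gV gG Guniq; apply/subspace_continuousP => x Dx.
have PF : ProperFilter (within D (nbhs x)) by apply: within_nbhs_proper; exact: subset_closure.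
apply: (compact_cluster_set1 hY cV (gV x Dx)) => /=.
  apply: filterS (withinT D (nbhs_filter x)) => z Dz; exact: nbhs_singleton (gV z Dz).
apply/seteqP; split=> [y Fy|_ ->].
  apply: Guniq => //; apply: cG => W [[N1 N2] /= [xN1 yN2] NW].
  have : (g x @[x --> within D (nbhs x)]) (g @` (N1 `&` D)).
    by rewrite /= /nbhs /=; apply: filterS xN1 => z N1z Dz; exists z.
  move=> /Fy /(_ yN2) [_ [[z [N1z Dz] <-] N2z]].
  by exists (z, g z); split; [exact: gG|exact: NW].
move=> P Q /= FP xQ; exists (g x); split; last exact: nbhs_singleton.
by have /= := nbhs_singleton FP; apply.
Qed.

(** * Signomials in logarithmic coordinates: uniqueness, existence and continuity of the critical
    pair *)

Section Signomial.
Set Implicit Arguments. Unset Strict Implicit.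
Variables (R : realType) (n : nat) (I J : finType).
Variables (p : I -> 'rV[R]_n) (q : J -> 'rV[R]_n) (h : J -> nat).
Implicit Types (A : I -> R) (B : J -> R) (t : R) (u v : 'rV[R]_n).

(** The exponents are arbitrary real vectors, and [t] enters only the negative terms because the
    height function vanishes on the positive support. *)
Definition signomial A B t u : R :=
  \sum_i A i * expR (dotv (p i) u) - \sum_j B j * t ^+ h j * expR (dotv (q j) u).

(** Differentiating an exponential sum along coordinate [l] multiplies each coefficient by the
    [l]-th coordinate of its exponent, so the gradient is expressed by signomials again. *)
Definition critical A B t u : Prop :=
  signomial A B t u = 0 /\
  forall l, signomial (fun i => A i * p i ord0 l) (fun j => B j * q j ord0 l) t u = 0.

(** An affine function is a combination of the constant 1 and the coordinates, and the critical
    equations are the identity for each of these. *)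
Lemma critical_affn A B t u L : critical A B t u ->
  \sum_i A i * expR (dotv (p i) u) * affn L (p i)
  = \sum_j B j * t ^+ h j * expR (dotv (q j) u) * affn L (q j).
Proof.
move=> [/eqP]; rewrite subr_eq0 => /eqP E0 E.
under eq_bigr do rewrite affn_dotv mulrDr mulr_sumr.
under [RHS]eq_bigr do rewrite affn_dotv mulrDr mulr_sumr.
rewrite !big_split /= -!mulr_suml E0; congr (_ + _).
rewrite exchange_big [RHS]exchange_big; apply: eq_bigr => l _ /=.
have /eqP := E l; rewrite subr_eq0 => /eqP El.
transitivity ((\sum_i A i * p i ord0 l * expR (dotv (p i) u)) * L.1 ord0 l).
  by rewrite mulr_suml; apply: eq_bigr => i _; ring.
by rewrite El mulr_suml; apply: eq_bigr => j _; ring.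
Qed.

Variables (j0 : J) (lam : I -> R) (eps : R).
Hypotheses (lam_gt0 : forall i, 0 < lam i) (lam_sum1 : \sum_i lam i = 1).
Hypothesis lam_bary : \sum_i lam i *: p i = q j0.
(* the affine functions attached to a cell of the common refinement of the
   regular subdivisions of [p] that contains all the [q j] *)
Hypothesis support : forall w : I -> R, exists L : 'rV[R]_n * R,
  (forall i, affn L (p i) <= w i) /\
  forall j, exists mu : I -> R, [/\ forall i, 0 <= mu i, \sum_i mu i = 1,
    \sum_i mu i *: p i = q j & \sum_i mu i * w i = affn L (q j)].
Hypothesis eps_gt0 : 0 < eps.
(* the [q j] are at distance at least [eps] from the boundary of the hull of [p] *)
Hypothesis coercive : forall j u l, exists i,
  dotv (q j) u + eps * `|u ord0 l| <= dotv (p i) u.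
Hypothesis h_gt0 : forall j, (0 < h j)%N.

Lemma critical_min A B t u v : (forall i, 0 < A i) -> (forall j, 0 <= B j) ->
  0 < B j0 -> 0 < t -> critical A B t u ->
  0 <= signomial A B t v /\ (signomial A B t v = 0 -> v = u).
Proof.
move=> A0 B0 Bj0 t0 cru.
pose w i := expR (dotv (p i) (v - u)).
have [L [Lw Lq]] := support w.
have expw r : expR (dotv r v) = expR (dotv r u) * expR (dotv r (v - u)).
  by rewrite dotvBr -expRD addrC subrK.
have le1 i : A i * expR (dotv (p i) u) * affn L (p i) <= A i * expR (dotv (p i) v).
  by rewrite expw -mulrA !ler_pM2l ?expR_gt0.
(* [L] at [q j] is a convex combination of the heights [w i], which are exponentials, so Jensen
   applies. *)
have qL j : expR (dotv (q j) (v - u)) <= affn L (q j).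
  have [mu [mu0 mu1 <- <-]] := Lq j.
  by rewrite dotv_suml expR_barycenter_le.
have le2 j : B j * t ^+ h j * expR (dotv (q j) v)
    <= B j * t ^+ h j * expR (dotv (q j) u) * affn L (q j).
  rewrite expw mulrA ler_wpM2l // !mulr_ge0 ?expR_ge0 // exprn_ge0 //; exact: ltW.
have cra := critical_affn L cru.
have sum1 : \sum_j B j * t ^+ h j * expR (dotv (q j) u) * affn L (q j)
    <= \sum_i A i * expR (dotv (p i) v) by rewrite -cra ler_sum.
have sum2 : \sum_j B j * t ^+ h j * expR (dotv (q j) v)
    <= \sum_j B j * t ^+ h j * expR (dotv (q j) u) * affn L (q j) by rewrite ler_sum.
split; first by rewrite subr_ge0; exact: le_trans sum2 sum1.
(* A zero at [v] turns the two sum inequalities into equalities, hence termwise ones: [L] meets [w]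
   at every [p i], and [le2] is sharp at [j0], whose coefficient is positive. *)
move/eqP; rewrite subr_eq0 => /eqP E.
have Lwi i : w i = affn L (p i).
  have /esym/eqP : A i * expR (dotv (p i) u) * affn L (p i) = A i * expR (dotv (p i) v).
    by apply: ler_sum_eq le1 _ i; rewrite E cra.
  rewrite expw mulrA -subr_eq0 -mulrBr mulf_eq0 subr_eq0.
  by rewrite gt_eqF ?mulr_gt0 ?expR_gt0 // => /eqP.
have Lqj : affn L (q j0) = expR (dotv (q j0) (v - u)).
  have /esym/eqP : B j0 * t ^+ h j0 * expR (dotv (q j0) v)
      = B j0 * t ^+ h j0 * expR (dotv (q j0) u) * affn L (q j0).
    by apply: ler_sum_eq le2 _ j0; rewrite -E.
  rewrite expw mulrA -subr_eq0 -mulrBr mulf_eq0 subr_eq0.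
  by rewrite gt_eqF ?mulr_gt0 ?expR_gt0 ?exprn_gt0 // => /eqP.
(* Jensen is sharp for the positive weights [lam], so all exponents coincide. *)
have cst i : dotv (p i) (v - u) = dotv (q j0) (v - u).
  rewrite -lam_bary dotv_suml.
  apply: (expR_barycenter_eq (y := fun i => dotv (p i) (v - u)) lam_gt0 lam_sum1).
  rewrite -dotv_suml lam_bary -Lqj -lam_bary affn_barycenter //.
  by apply: ler_sum => k _; rewrite -Lwi.
(* With all these pairings equal, coercivity leaves [eps] times the absolute value of coordinate [l]
   of [v - u] at most 0. *)
apply/eqP; rewrite -subr_eq0; apply/eqP/rowP => l; rewrite [RHS]mxE.
have [i] := coercive j0 (v - u) l.
by rewrite cst gerDl pmulr_rle0 // normr_le0 => /eqP.
Qed.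

(** Strictness comes from the term [j0] alone; the other [B j] may vanish, as they do at the start
    of the homotopy. *)
Lemma signomial_decr A B t t' u : (forall j, 0 <= B j) -> 0 < B j0 ->
  0 <= t -> t < t' -> signomial A B t' u < signomial A B t u.
Proof.
move=> B0 Bj0 t0 tt'; rewrite ltrD2l ltrN2 (bigD1 j0) //= [ltRHS](bigD1 j0) //=.
rewrite ltr_leD //.
  by rewrite ltr_pM2r ?expR_gt0 // ltr_pM2l // ltrXn2r ?lt0n_neq0 // ltW.
apply: ler_sum => j _; rewrite ler_pM2r ?expR_gt0 // ler_wpM2l //.
by rewrite lerXn2r // ?nnegrE ?(ltW tt') // ltW // (le_lt_trans t0).
Qed.

(** If one parameter were smaller, its critical zero would give a negative value for the larger
    parameter, against [critical_min]. Once the parameters agree, the zero is unique. *)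
Lemma critical_unique A B t u t' u' :
  (forall i, 0 < A i) -> (forall j, 0 <= B j) -> 0 < B j0 -> 0 < t -> 0 < t' ->
  critical A B t u -> critical A B t' u' -> t' = t /\ u' = u.
Proof.
move=> A0 B0 Bj0; have wlog_lt s v s' v' : 0 < s -> 0 < s' -> critical A B s v ->
    critical A B s' v' -> ~~ (s < s').
  move=> s0 s'0 crs crs'; apply/negP => /(signomial_decr A v B0 Bj0 (ltW s0)).
  have [+ _] := critical_min v A0 B0 Bj0 s'0 crs'.
  by case: crs => -> _ /le_lt_trans lt /lt; rewrite ltxx.
move=> t0 t'0 cr cr'; have tt' : t' = t.
  by apply/eqP; rewrite eq_le !leNgt !(wlog_lt _ _ _ _ _ _ cr cr', wlog_lt _ _ _ _ _ _ cr' cr).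
split=> //; rewrite tt' in cr'; have [_] := critical_min u' A0 B0 Bj0 t0 cr.
by apply; case: cr'.
Qed.

Lemma continuous_signomial (X : topologicalType) (A : X -> I -> R)
    (B : X -> J -> R) (t : X -> R) (u : X -> 'rV[R]_n) :
  (forall i, continuous (A^~ i)) -> (forall j, continuous (B^~ j)) ->
  continuous t -> continuous u ->
  continuous (fun x => signomial (A x) (B x) (t x) (u x)).
Proof.
move=> cA cB ct cu.
have cdot r : continuous (fun x => expR (dotv r (u x))).
  move=> x; apply: continuous_comp; last exact: continuous_expR.
  apply: cvg_big => [|l _]; first exact: add_continuous.
  apply: cvgM; first exact: cvg_cst.
  apply: (cvg_comp u (fun v : 'rV[R]_n => v ord0 l)); first exact: cu.
  exact: coord_continuous.
move=> x; apply: cvgB; (apply: cvg_big => [|i _]; first exact: add_continuous).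
  by apply: cvgM; [exact: cA|exact: cdot].
apply: cvgM; last exact: cdot.
apply: cvgM; first exact: cB.
by apply: (cvg_comp t (fun y => y ^+ h i)); [exact: ct|exact: exprn_continuous].
Qed.

Variables kap K : R.
Hypothesis kap_gt0 : 0 < kap.

(** Coefficient bounds meant to hold along the whole homotopy; among the [B j] only [B j0] stays
    away from 0. *)
Definition pinched A B := [/\ forall i, kap <= A i <= K,
  forall j, 0 <= B j <= K & kap <= B j0].

Lemma pinched_sign A B : pinched A B ->
  [/\ forall i, 0 < A i, forall j, 0 <= B j & 0 < B j0].
Proof.
move=> [AK BK Bj0]; split; last exact: lt_le_trans Bj0.
  by move=> i; case/andP: (AK i) => /(lt_le_trans kap_gt0).
by move=> j; case/andP: (BK j).
Qed.

(** For [t >= 1], nonnegativity at [u = 0] forces [kap * t] to be at most the sum of the [K]; the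
    added 1 covers [t < 1] and makes the bound strict. *)
Definition tbound : R := 1 + (\sum_(i : I) K) / kap.
Definition ubound : R := (\sum_j K * tbound ^+ h j) / kap / eps.

Lemma dotv0 r : dotv r (0 : 'rV[R]_n) = 0.
Proof. by rewrite /dotv big1 // => l _; rewrite mxE mulr0. Qed.

Lemma signomial_at0 A B t : signomial A B t 0 = \sum_i A i - \sum_j B j * t ^+ h j.
Proof.
by congr (_ - _); apply: eq_bigr => i _; rewrite dotv0 expR0 mulr1.
Qed.

Lemma tbound_ge1 A B : pinched A B -> 1 <= tbound.
Proof.
move=> [_ BK _]; rewrite lerDl divr_ge0 ?(ltW kap_gt0) // sumr_ge0 // => i _.
by case/andP: (BK j0) => /le_trans; apply.
Qed.

Lemma lt_tbound A B t : pinched A B -> 0 <= signomial A B t 0 -> t < tbound.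
Proof.
move=> pAB; have [AK BK Bj0] := pAB; rewrite signomial_at0 subr_ge0 => le_BA.
have [t1|t1] := ltP t 1; first exact: lt_le_trans t1 (tbound_ge1 pAB).
have t0 : 0 <= t by rewrite (le_trans _ t1).
apply: (@le_lt_trans _ _ ((\sum_(i : I) K) / kap)); last by rewrite ltrDr.
rewrite ler_pdivlMr // mulrC; apply: (@le_trans _ _ (\sum_i A i)); last first.
  by apply: ler_sum => i _; case/andP: (AK i).
apply: le_trans le_BA; apply: (@le_trans _ _ (B j0 * t ^+ h j0)).
  by apply: ler_pM => //; [exact: ltW|rewrite ler_eXnr ?h_gt0].
rewrite (bigD1 j0) //= lerDl sumr_ge0 // => j _.
by rewrite mulr_ge0 ?exprn_ge0 //; case/andP: (BK j).
Qed.

(** Take [j] maximising the exponent of the negative terms. Some positive term exceeds it by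
    [eps * |u_l|] in the exponent, so dividing by that maximal exponential bounds
    [kap * expR (eps * |u_l|)], and [expR y >= 1 + y] gives a linear bound. *)
Lemma le_ubound A B t u l : pinched A B -> 0 <= t <= tbound ->
  signomial A B t u <= 0 -> `|u ord0 l| <= ubound.
Proof.
move=> [AK BK Bj0] /andP[t0 tT]; rewrite subr_le0 => le_AB.
have [j _ jmax] := @Order.TotalTheory.arg_maxP _ _ _ j0 predT (fun j => dotv (q j) u) isT.
have [i le_qp] := coercive j u l.
rewrite !ler_pdivlMr // [_ * eps]mulrC [_ * kap]mulrC.
set C := \sum_j _.
suff : kap * expR (eps * `|u ord0 l|) <= C.
  move=> le_C; apply: le_trans le_C; rewrite ler_pM2l // (le_trans _ (expR_ge1Dx _)) //.
  by rewrite lerDr.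
rewrite -(ler_pM2r (expR_gt0 (dotv (q j) u))) -mulrA -expRD addrC.
apply: (@le_trans _ _ (\sum_i A i * expR (dotv (p i) u))).
  rewrite (bigD1 i) //= -[leLHS]addr0 lerD //.
    by rewrite ler_pM ?expR_ge0 ?ler_expR ?(ltW kap_gt0) //; case/andP: (AK i).
  apply: sumr_ge0 => r _; rewrite mulr_ge0 ?expR_ge0 //.
  by case/andP: (AK r) => /(le_trans (ltW kap_gt0)).
apply: le_trans le_AB _; rewrite mulr_suml; apply: ler_sum => r _.
case/andP: (BK r) => B0 BrK.
apply: ler_pM; rewrite ?expR_ge0 ?mulr_ge0 ?exprn_ge0 ?ler_expR //; last exact: jmax.
by apply: ler_pM; rewrite ?exprn_ge0 // lerXn2r // nnegrE // (le_trans t0).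
Qed.

Lemma signomial_t0_gt0 A B v : pinched A B -> 0 < signomial A B 0 v.
Proof.
move=> /pinched_sign[A0 _ _].
(* [I] is nonempty because the [lam i] sum to 1. *)
have [i0 _] : exists i, true && (0 < lam i).
  by apply: psumr_neq0P => [i _|]; [exact: ltW|rewrite lam_sum1; exact/eqP/oner_neq0].
rewrite /signomial [X in _ - X]big1 => [|j _]; last first.
  by rewrite expr0n gtn_eqF ?h_gt0 // mulr0 mul0r.
rewrite subr0 (bigD1 i0) //= ltr_wpDr ?mulr_gt0 ?expR_gt0 // sumr_ge0 // => i _.
by rewrite mulr_ge0 ?expR_ge0 // ltW.
Qed.

Lemma exists_min_zero A B : pinched A B ->
  exists t u, [/\ 0 < t, signomial A B t u = 0 & forall v, 0 <= signomial A B t v].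
Proof.
move=> pAB; have [AK BK Bj0] := pAB.
have csig : continuous (fun x : R * 'rV[R]_n => signomial A B x.1 x.2).
  apply: continuous_signomial => [i|j||] x; [exact: cvg_cst|exact: cvg_cst| |].
    exact: cvg_fst.
  exact: cvg_snd.
pose box := `[0, tbound]%classic `*`
  [set v : 'rV[R]_n | forall l, `[- ubound, ubound]%classic (v ord0 l)].
pose Z := box `&` [set x | signomial A B x.1 x.2 <= 0].
have inZ t u : 0 <= t <= tbound -> signomial A B t u <= 0 -> Z (t, u).
  move=> tT le0; split=> //; split=> /=; first by rewrite in_itv.
  by move=> l /=; rewrite in_itv /= -ler_norml (le_ubound l pAB tT).
have cbox : compact box.
  apply: compact_setX; first exact: segment_compact.
  by apply: (@rV_compact R n (fun=> `[- ubound, ubound]%classic)) => l; exact: segment_compact.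
have cZ : compact Z.
  apply: compact_closedI => //.
  exact: (preimage_closed (fun x _ => csig x) (@closed_le R 0)).
have Z0 : Z !=set0.
  (* A positive value at this point would give [tbound < tbound] by [lt_tbound]. *)
  exists (tbound, 0); apply: inZ.
    by rewrite lexx (le_trans ler01 (tbound_ge1 pAB)).
  by have [//|/ltW /(lt_tbound pAB)] := leP (signomial A B tbound 0) 0; rewrite ltxx.
have [|[t u] /set_mem [/= [/= +  _] le0] tmin] := compact_EVT_min (f := fst) Z0 cZ.
  by apply: continuous_subspaceT => x; exact: cvg_fst.
rewrite in_itv /= => tT; have /andP[t0 tT'] := tT.
have sig0 v := signomial_t0_gt0 v pAB.
have sig_ge0 v : 0 <= signomial A B t v.
  rewrite leNgt; apply/negP => sigt.
  (* The value at parameter 0 is positive, so a negative value at [t] yields a zero at some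
     [c <= t]; minimality of [t] gives [c = t], a contradiction. *)
  have [||c] := @IVT R (fun s => signomial A B s v) 0 t 0 t0.
  - apply: continuous_subspaceT; apply: continuous_signomial => [i|j||] x;
      [exact: cvg_cst|exact: cvg_cst|exact: cvg_id|exact: cvg_cst].
  - by rewrite ge_min le_max (ltW sigt) (ltW (sig0 v)) orbT.
  rewrite in_itv /= => /andP[c0 ct] sigc.
  have /mem_set/tmin /= tc : Z (c, v) by apply: inZ; rewrite ?sigc // c0 (le_trans ct).
  have ctE : c = t by apply/eqP; rewrite eq_le ct.
  by rewrite -ctE sigc ltxx in sigt.
exists t, u; split=> //; last by apply/eqP; rewrite eq_le le0 sig_ge0.
by rewrite lt0r t0 andbT; apply: contraTneq le0 => ->; rewrite -ltNge.
Qed.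

Lemma continuous_critical_path (D : set R) (A : R -> I -> R) (B : R -> J -> R)
    (g : R -> R * 'rV[R]_n) :
  (forall i, continuous (A^~ i)) -> (forall j, continuous (B^~ j)) ->
  (forall s, D s -> pinched (A s) (B s)) ->
  (forall s, D s -> 0 < (g s).1 /\ critical (A s) (B s) (g s).1 (g s).2) ->
  {within D, continuous g}.
Proof.
move=> cA cB pAB gcr.
pose sig (A : R -> I -> R) (B : R -> J -> R) (z : R * (R * 'rV[R]_n)) :=
  signomial (A z.1) (B z.1) z.2.1 z.2.2.
have csig (A' : R -> I -> R) (B' : R -> J -> R) :
    (forall i, continuous (A'^~ i)) -> (forall j, continuous (B'^~ j)) ->
    continuous (sig A' B').
  move=> cA' cB'; apply: (@continuous_signomial _ (fun z => A' z.1) (fun z => B' z.1)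
    (fun z : R * (R * 'rV[R]_n) => z.2.1) (fun z : R * (R * 'rV[R]_n) => z.2.2))
    => [i|j||] z.
  - by apply: (@continuous_comp _ _ _ fst (A'^~ i)); [exact: cvg_fst|exact: cA'].
  - by apply: (@continuous_comp _ _ _ fst (B'^~ j)); [exact: cvg_fst|exact: cB'].
  - by apply: (@continuous_comp _ _ _ snd fst); [exact: cvg_snd|exact: cvg_fst].
  - by apply: (@continuous_comp _ _ _ snd snd); [exact: cvg_snd|exact: cvg_snd].
have closed_zero (A' : R -> I -> R) (B' : R -> J -> R) :
    (forall i, continuous (A'^~ i)) -> (forall j, continuous (B'^~ j)) ->
    closed [set z | sig A' B' z = 0].
  move=> cA' cB'.
  exact: (preimage_closed (fun z _ => csig _ _ cA' cB' z) (@closed_eq R 0)).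
(* The weak inequality on [t] keeps [G] closed; [t = 0] is excluded afterwards by
   [signomial_t0_gt0]. *)
pose G := [set z : R * (R * 'rV[R]_n) | 0 <= z.2.1] `&` ([set z | sig A B z = 0] `&`
  \bigcap_l [set z | sig (fun s i => A s i * p i ord0 l)
                         (fun s j => B s j * q j ord0 l) z = 0]).
(* Enlarging the bounds by 1 puts the values of [g] in the interior of the compact set [V]. *)
pose cube := `[- (ubound + 1), ubound + 1]%classic.
pose box := [set v : 'rV[R]_n | forall l, cube (v ord0 l)].
pose V := `[-1, tbound + 1]%classic `*` box.
apply: (@closed_graph_continuous _ _ D V G).
- exact: norm_hausdorff.
- apply: compact_setX; first exact: segment_compact.
  by apply: (@rV_compact R n (fun=> cube)) => l; exact: segment_compact.
- apply: closedI.
    apply: (@preimage_closed _ _ (fun z : R * (R * 'rV[R]_n) => z.2.1) [set t | 0 <= t]);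
      last exact: closed_ge.
    by move=> z _; apply: (@continuous_comp _ _ _ snd fst); [exact: cvg_snd|exact: cvg_fst].
  apply: closedI; first exact: closed_zero.
  apply: closed_bigI => l _; apply: closed_zero => i x; apply: cvgM; try exact: cvg_cst.
    exact: cA.
  exact: cB.
- move=> s Ds; have [gt0 gs] := gcr s Ds.
  have [A0 B0 Bj0] := pinched_sign (pAB s Ds).
  have [sig0 _] := critical_min 0 A0 B0 Bj0 gt0 gs.
  have tT := lt_tbound (pAB s Ds) sig0.
  exists (`[-1, tbound + 1]%classic, box); last by [].
  split=> /=.
    have : (g s).1 \in `](-1), (tbound + 1)[.
      by rewrite in_itv /=; apply/andP; split; lra.
    move/near_in_itvoo; apply: filterS => z.
    by rewrite /= !in_itv /= => /andP[/ltW -> /ltW ->].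
  exists (fun _ _ => cube) => [i l|v vI l]; last exact: vI.
  have : (g s).2 i l \in `](- (ubound + 1)), (ubound + 1)[.
    rewrite in_itv /= -ltr_norml (ord1 i).
    rewrite (@le_lt_trans _ _ ubound) ?ltrDl ?ltr01 //.
    by apply: (le_ubound (t := (g s).1) l (pAB s Ds)); [rewrite !ltW|case: gs => ->].
  move/near_in_itvoo; apply: filterS => z.
  by rewrite /cube /= !in_itv /= => /andP[/ltW -> /ltW ->].
- move=> s Ds; have [gt0 [gs0 gsl]] := gcr s Ds.
  by split; [exact: ltW|split=> // l _; exact: gsl].
move=> s [t u] Ds [/= t0 [/= sig0 sigl]]; have [gt0 gs] := gcr s Ds.
have [A0 B0 Bj0] := pinched_sign (pAB s Ds).
have tp : 0 < t.
  rewrite lt0r t0 andbT; apply/eqP => tE; have := signomial_t0_gt0 u (pAB s Ds).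
  by move: sig0; rewrite /sig /= tE => ->; rewrite ltxx.
have cr : critical (A s) (B s) t u by split=> // l; exact: sigl.
have [-> ->] := critical_unique A0 B0 Bj0 gt0 tp gs cr.
by case: (g s).
Qed.

End Signomial.

(** * Derivatives of Laurent polynomials on the positive orthant and passage to logarithmic
    coordinates *)

Section CriticalSystem.
Set Implicit Arguments. Unset Strict Implicit.
Variables (R : realType) (n : nat).
Implicit Types (x v : 'rV[R]_n).

(** Both sides have the same difference quotient; this reduces directional derivatives to
    one-variable calculus. *)
Lemma is_derive_line (f : 'rV[R]_n -> R) x v (s d : R) :
  is_derive s (1 : R) (fun h : R => f (x + h *: v)) d <-> is_derive (x + s *: v) v f d.
Proof.
have E : (fun h : R =>
      h^-1 *: (((fun h => f (x + h *: v)) \o shift s) (h *: 1) - f (x + s *: v)))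
    = (fun h : R => h^-1 *: ((f \o shift (x + s *: v)) (h *: v) - f (x + s *: v))).
  apply/funext => h; congr (_ *: (f _ - _)) => /=.
  by rewrite [h *: 1]mulr1 scalerDl addrCA.
split=> -[]; rewrite /derivable /derive ?E => dv dE; constructor;
  rewrite /derivable /derive ?E //.
Qed.

Lemma is_derive_exprz (z : int) (y : R) : y != 0 ->
  is_derive y (1 : R) (fun w => w ^ z) (z%:~R * y ^ z / y).
Proof.
move=> y0; case: z => [k|k].
  have -> : (fun w : R => w ^ Posz k) = (id : R -> R) ^+ k.
    by apply/funext => w; rewrite exprfctE.
  apply: is_derive_eq; rewrite [_ *: 1]mulr1 -exprnP /=; case: k => [|k] /=.
    by rewrite !mul0r.
  by rewrite exprS; field.
have -> : (fun w : R => w ^ Negz k) = (fun w => (((id : R -> R) ^+ k.+1) w)^-1).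
  by apply/funext => w; rewrite exprfctE.
have E : ((id : R -> R) ^+ k.+1) y != 0 by rewrite exprfctE expf_neq0.
have d := is_deriveV E (is_deriveX k.+1 (is_derive_id y (1 : R))).
apply: (is_derive_eq d).
have -> : ((id : R -> R) ^+ k.+1) y = y * y ^+ k by rewrite exprfctE exprS.
rewrite /GRing.scale /= -[y ^ Negz k]/((y ^+ k.+1)^-1) NegzE mulrNz -pmulrn (exprS y).
by field; rewrite y0 expf_neq0.
Qed.

Lemma monom_line (a : 'rV[int]_n) x l (h : R) :
  monom (x + h *: delta_mx ord0 l) a =
  (\prod_(j < n | j != l) x ord0 j ^ a ord0 j) * (x ord0 l + h) ^ a ord0 l.
Proof.
rewrite /monom (bigD1 l) //= mulrC; congr (_ * _).
  by apply: eq_bigr => j jl; rewrite !mxE (negPf jl) andbF mulr0 addr0.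
by rewrite !mxE !eqxx mulr1.
Qed.

Lemma is_derive_monom (a : 'rV[int]_n) x l : x ord0 l != 0 ->
  is_derive x (delta_mx ord0 l) (fun y => monom y a)
    ((a ord0 l)%:~R * monom x a / x ord0 l).
Proof.
(* Rewrite [x] as the point of parameter 0 on its coordinate line. *)
move=> xl0; rewrite -[x in is_derive x]addr0.
rewrite -[X in is_derive (x + X)](scale0r (delta_mx ord0 l)).
apply/is_derive_line.
under eq_fun do rewrite monom_line.
set C := \prod_(j < n | _) _.
have dz : is_derive (x ord0 l + 0) (1 : R) (fun w => w ^ a ord0 l)
    ((a ord0 l)%:~R * x ord0 l ^ a ord0 l / x ord0 l).
  by rewrite addr0; exact: is_derive_exprz.
have dl : is_derive (0 : R) (1 : R) (fun h => x ord0 l + h) 1.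
  have -> : (fun h : R => x ord0 l + h) = shift (x ord0 l).
    by apply/funext => h; rewrite /= addrC.
  exact: is_derive_shift.
have dC := is_deriveZ C (is_derive1_comp dz dl).
apply: (is_derive_eq dC).
rewrite mulr1 /monom (bigD1 l) //= /C /GRing.scale /=; ring.
Qed.

Variables (k m : nat) (a : 'I_k -> 'rV[int]_n) (b : 'I_m -> 'rV[int]_n).

Lemma is_derive_fpoly (cp : 'I_k -> R) (cm : 'I_m -> R) x l : x ord0 l != 0 ->
  is_derive x (delta_mx ord0 l) (fpoly a b cp cm)
    (fpoly a b (fun i => cp i * (a i ord0 l)%:~R)
       (fun j => cm j * (b j ord0 l)%:~R) x / x ord0 l).
Proof.
move=> xl0.
have -> : fpoly a b cp cm = \sum_i (cp i \*: (fun y => monom y (a i)))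
                          - \sum_j (cm j \*: (fun y => monom y (b j))).
  by apply/funext => y; rewrite fctE !fct_sumE.
apply: is_derive_eq.
  by apply: is_deriveB; apply: is_derive_sum => i; apply: is_deriveZ; exact: is_derive_monom.
rewrite /fpoly mulrBl !mulr_suml.
by congr (_ - _); apply: eq_bigr => i _; rewrite /GRing.scale /=; ring.
Qed.

(** The Euler operator [x_l d/dx_l] multiplies each coefficient by the [l]-th exponent, which
    removes derivatives from the critical system. *)
Lemma crit_eq0 (cp : 'I_k -> R) (cm : 'I_m -> R) x : (forall l, 0 < x ord0 l) ->
  crit a b cp cm x = 0 <-> fpoly a b cp cm x = 0 /\
    forall l, fpoly a b (fun i => cp i * (a i ord0 l)%:~R)
       (fun j => cm j * (b j ord0 l)%:~R) x = 0.
Proof.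
move=> x0; have xl0 l : x ord0 l != 0 by rewrite gt_eqF.
have dE l : x ord0 l * derive (fpoly a b cp cm) x (delta_mx ord0 l) =
    fpoly a b (fun i => cp i * (a i ord0 l)%:~R) (fun j => cm j * (b j ord0 l)%:~R) x.
  by have [_ ->] := is_derive_fpoly cp cm (xl0 l); rewrite mulrC divfK.
split=> [/rowP E|[f0 fl]].
  split; first by have := E ord0; rewrite !mxE unlift_none.
  by move=> l; have := E (lift ord0 l); rewrite !mxE liftK dE.
by apply/rowP => r; rewrite !mxE; case: unliftP => [l _|_] //; rewrite dE.
Qed.

(** Fermat's rule on each coordinate line: for [|h| < x_l] the line stays in the positive orthant,
    where the value 0 at [x] is minimal. *)
Lemma crit_min_zero (cp : 'I_k -> R) (cm : 'I_m -> R) x :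
  (forall l, 0 < x ord0 l) -> fpoly a b cp cm x = 0 ->
  (forall y : 'rV[R]_n, (forall l, 0 < y ord0 l) -> 0 <= fpoly a b cp cm y) ->
  crit a b cp cm x = 0.
Proof.
move=> x0 f0 fge0; apply/crit_eq0 => //; split=> // l.
pose line h := x + h *: delta_mx ord0 l.
have line_gt0 h : h \in `](- x ord0 l), (x ord0 l)[ -> forall j, 0 < line h ord0 j.
  rewrite in_itv /= => /andP[hl _] j; rewrite !mxE eqxx /=.
  by case: eqVneq => [->|_]; rewrite ?mulr1 ?mulr0 ?addr0 // -ltrBlDl sub0r.
have line_der h : h \in `](- x ord0 l), (x ord0 l)[ -> 
    derivable (fun h => fpoly a b cp cm (line h)) h (1 : R).
  move=> /line_gt0 /(_ l) /lt0r_neq0 /(is_derive_fpoly cp cm) /is_derive_line.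
  by case.
have in0 : 0 \in `](- x ord0 l), (x ord0 l)[ by rewrite in_itv /= oppr_lt0 x0.
have line0 : line 0 = x by rewrite /line scale0r addr0.
have le_x : - x ord0 l <= x ord0 l by rewrite ge0_cp // ltW.
have [|_ d0] := derive1_at_min le_x line_der in0.
  by move=> h /line_gt0 /fge0; rewrite line0 f0.
have := is_derive_fpoly cp cm (lt0r_neq0 (line_gt0 0 in0 l)).
move=> /is_derive_line [_]; rewrite d0 => /esym /eqP.
by rewrite line0 mulf_eq0 invr_eq0 (gt_eqF (x0 l)) orbF => /eqP.
Qed.

Lemma monom_exp (r : 'rV[int]_n) (u : 'rV[R]_n) :
  monom (map_mx (@expR R) u) r = expR (dotv (pt R r) u).
Proof.
rewrite /dotv expR_sum; apply: eq_bigr => l _; rewrite !mxE.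
case: (r ord0 l) => z; first by rewrite -exprnP -expRM_natl.
by rewrite NegzE -exprnN mulrNz mulNr expRN -expRM_natl.
Qed.

Lemma fpoly_exp (A : 'I_k -> R) (B : 'I_m -> R) (h : 'I_m -> nat) (t : R) u :
  fpoly a b A (fun j => B j * t ^+ h j) (map_mx (@expR R) u) =
  signomial (fun i => pt R (a i)) (fun j => pt R (b j)) h A B t u.
Proof. by congr (_ - _); apply: eq_bigr => i _; rewrite monom_exp. Qed.

Lemma crit_exp (A : 'I_k -> R) (B : 'I_m -> R) (h : 'I_m -> nat) (t : R) u :
  crit a b A (fun j => B j * t ^+ h j) (map_mx (@expR R) u) = 0 <->
  critical (fun i => pt R (a i)) (fun j => pt R (b j)) h A B t u.
Proof.
rewrite crit_eq0 => [|l]; last by rewrite mxE expR_gt0.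
rewrite fpoly_exp /critical; split=> -[f0 fl]; split=> // l; have := fl l;
  rewrite -!fpoly_exp => <-; congr (_ - _); apply: eq_bigr => i _ /=; rewrite !mxE //;
  by congr (_ * _); ring.
Qed.

End CriticalSystem.

(** * From nonseparability to the supporting affine functions and the coercivity estimate *)

Section Nonseparable.
Set Implicit Arguments. Unset Strict Implicit.
Variables (R : realType) (n : nat).

(** [aff_hull] ranges over sequences of points, so a finite family enters through its [codom], with
    indices transported by [cast_ord]. *)
Lemma aff_hull_barycenter (X : set 'rV[R]_n) N (f : 'I_N -> 'rV[R]_n) (nu : 'I_N -> R) :
  (forall i, X (f i)) -> \sum_i nu i = 1 -> aff_hull X (\sum_i nu i *: f i).
Proof.
move=> Xf nu1; have sz : size (codom f) = N by rewrite size_codom card_ord.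
exists (codom f), (fun i => nu (cast_ord sz i)); split; first by move=> v /codomP[i ->].
have rein (V : nmodType) (F : 'I_N -> V) :
    \sum_i F i = \sum_(i < size (codom f)) F (cast_ord sz i).
  rewrite (reindex (cast_ord sz)) //.
  exists (cast_ord (esym sz)) => i _; [exact: cast_ordK|exact: cast_ordKV].
split; first by rewrite -rein.
rewrite rein; apply: eq_bigr => i _; congr (_ *: _).
have iN : (i < N)%N := ltn_ord (cast_ord sz i).
rewrite /codom /image_mem (nth_map (cast_ord sz i)) ?size_enum_ord //.
by congr (f _); apply: val_inj; rewrite /= nth_enum_ord.
Qed.

(** Expand [z - x0] in the basis [vs] and give [x0] the remaining weight. Relative interior thereby
    becomes interior. *)
Lemma full_dim_aff_hull (X D : set 'rV[R]_n) : D `<=` X -> full_dim D ->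
  forall z, aff_hull X z.
Proof.
move=> DX [x0 [vs [Dx0 [Dvs free]]]] z.
pose M := \matrix_(i < n) vs i; pose c := (z - x0) *m invmx M.
pose f (r : 'I_n.+1) := if unlift ord0 r is Some i then x0 + vs i else x0.
pose nu (r : 'I_n.+1) := if unlift ord0 r is Some i then c ord0 i else 1 - \sum_i c ord0 i.
have fE i : f (lift ord0 i) = x0 + vs i by rewrite /f liftK.
have nuE i : nu (lift ord0 i) = c ord0 i by rewrite /nu liftK.
have f0 : f ord0 = x0 by rewrite /f unlift_none.
have nu0 : nu ord0 = 1 - \sum_i c ord0 i by rewrite /nu unlift_none.
have -> : z = \sum_r nu r *: f r.
  rewrite big_ord_recl; under eq_bigr do rewrite fE nuE scalerDr.
  rewrite f0 nu0 big_split /= -scaler_suml addrA -scalerDl subrK scale1r.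
  have -> : \sum_i c ord0 i *: vs i = c *m M.
    by rewrite mulmx_sum_row; apply: eq_bigr => i _; rewrite rowK.
  by rewrite mulmxKV -?row_free_unit // subrKC.
apply: aff_hull_barycenter => [r|].
  by apply: DX; rewrite /f; case: unliftP.
rewrite big_ord_recl; under eq_bigr do rewrite nuE.
by rewrite nu0 subrK.
Qed.

Variables (k m : nat) (a : 'I_k.+1 -> 'rV[int]_n) (b : 'I_m.+1 -> 'rV[int]_n).
Hypothesis nonsep : nonseparable R a b.

(** The weights [mu] of a point of the cell vanish wherever [L w] and [w] differ, so averaging [w]
    is averaging [L w]. *)
Lemma nonseparable_support (w : 'I_k.+1 -> R) : exists L : 'rV[R]_n * R,
  (forall i, affn L (pt R (a i)) <= w i) /\
  forall j, exists mu : 'I_k.+1 -> R, [/\ forall i, 0 <= mu i, \sum_i mu i = 1,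
    \sum_i mu i *: pt R (a i) = pt R (b j) &
    \sum_i mu i * w i = affn L (pt R (b j))].
Proof.
have [_ [L [Lw [_ Db]]]] := nonsep.
exists (L w); split=> // j; have [mu [mu0 [muP [mu1 ->]]]] := Db j w.
exists mu; split=> //; rewrite affn_barycenter //; apply: eq_bigr => i _.
by have [/eqP -> //|/muP ->] := boolP (affn (L w) (pt R (a i)) == w i); rewrite !mul0r.
Qed.

Lemma hull_support (I : finType) (i0 : I) (p : I -> 'rV[R]_n) z u :
  cvx_hull p predT z -> exists i, dotv z u <= dotv (p i) u.
Proof.
move=> [mu [mu0 [_ [mu1 ->]]]].
have [i _ imax] := @Order.TotalTheory.arg_maxP _ _ _ i0 predT (fun i => dotv (p i) u) isT.
exists i; rewrite dotv_suml -[leRHS]mul1r -mu1 mulr_suml.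
by apply: ler_sum => r _; apply: ler_wpM2l => //; exact: imax.
Qed.

(** Moving [b j] by [eps] along coordinate [l] in the direction of the sign of [u_l] stays in the
    hull and raises the pairing with [u] by [eps * |u_l|]; some vertex pairs at least as high. *)
Lemma nonseparable_coercive : exists2 eps : R, 0 < eps & forall j u l, exists i,
  dotv (pt R (b j)) u + eps * `|u ord0 l| <= dotv (pt R (a i)) u.
Proof.
have [ri [L [_ [fd _]]]] := nonsep.
have aff z : aff_hull (cvx_hull (fun i => pt R (a i)) predT) z.
  (* Any height vector shows that the cell lies in the hull; the zero one is taken. *)
  apply: full_dim_aff_hull fd z => y Dy; have [mu [mu0 [_ mu1]]] := Dy (fun=> 0).
  by exists mu.
have /choice [e eP] : forall j, exists e : R, 0 < e /\ forall z,
    ball (pt R (b j)) e z -> cvx_hull (fun i => pt R (a i)) predT z.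
  by move=> j; have [_ [e e0 eP]] := ri j; exists e; split=> // z; exact: eP.
have [j1 _ jmin] := @Order.TotalTheory.arg_minP _ _ _ ord0 predT e isT.
have [e0 _] := eP j1.
(* The smallest radius serves all [j]; it is halved because the balls are open. *)
exists (e j1 / 2); first exact: divr_gt0.
move=> j u l.
pose z := pt R (b j) + (e j1 / 2 * Num.sg (u ord0 l)) *: delta_mx ord0 l.
have [_ /(_ z)] := eP j; case=> [|mu mup].
  split=> [|i r]; first by rewrite (lt_le_trans e0) // jmin.
  rewrite !mxE /ball /= opprD addNKr normrN.
  apply: le_lt_trans (_ : e j1 / 2 < _); last first.
    by rewrite (lt_le_trans _ (jmin j isT)) // ltr_pdivrMr // mulr_natr mulr2n ltrDr.
  rewrite !normrM normr_sg normr_nat normrV ?unitfE // normr_nat (gtr0_norm e0).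
  rewrite -mulrA ger_pMr ?divr_gt0 // -natrM lern1.
  by case: (_ != 0); case: (_ && _).
have [i le_i] := hull_support ord0 u (ex_intro _ mu mup).
exists i; apply: le_trans le_i.
by rewrite dotvDl dotv_delta normrEsg mulrA.
Qed.
End Nonseparable.

(** * Coefficients along the segment, with bounds uniform in [s] *)

Section Homotopy.
Set Implicit Arguments. Unset Strict Implicit.

Lemma continuous_map_mx (R : realType) (n : nat) (f : R -> R) :
  continuous f -> continuous (map_mx f : 'rV[R]_n -> 'rV[R]_n).
Proof.
move=> cf u W [P uP PW]; exists (fun i j => f @^-1` P i j) => [i j|v vP].
  by apply: cf; have := uP i j; rewrite mxE.
by apply: PW => i j; rewrite mxE; exact: vP.
Qed.

Lemma map_mx_lnK (R : realType) (n : nat) (x : 'rV[R]_n) :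
  (forall l, 0 < x ord0 l) -> map_mx (@expR R) (map_mx (@ln R) x) = x.
Proof. by move=> x0; apply/rowP => l; rewrite !mxE lnK // posrE. Qed.

Lemma affine_bounds (R : realType) (kap K x y s : R) :
  kap <= x <= K -> kap <= y <= K -> 0 <= s <= 1 -> kap <= s * x + (1 - s) * y <= K.
Proof.
by move=> /andP[? ?] /andP[? ?] /andP[? ?]; apply/andP; split; nra.
Qed.

Lemma continuous_affine (R : realType) (x y : R) :
  continuous (fun s : R => s * x + (1 - s) * y).
Proof.
move=> s; apply: cvgD; apply: cvgM; try exact: cvg_cst; first exact: cvg_id.
by apply: cvgB; [exact: cvg_cst|exact: cvg_id].
Qed.

Lemma exists_pinch (R : realType) (k m : nat) (cp lam : 'I_k.+1 -> R) (cm : 'I_m.+1 -> R) :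
  (forall i, 0 < cp i) -> (forall i, 0 < lam i) -> (forall j, 0 < cm j) ->
  exists kap K : R, 0 < kap /\ forall s : R, 0 <= s <= 1 ->
    pinched ord0 kap K (fun i => s * cp i + (1 - s) * lam i)
      (fun j => s * cm j + (1 - s) * (if j == ord0 then 1 else 0)).
Proof.
move=> cp0 lam0 cm0.
have [i1 _ min1] := @Order.TotalTheory.arg_minP _ _ _ ord0 predT cp isT.
have [i2 _ min2] := @Order.TotalTheory.arg_minP _ _ _ ord0 predT lam isT.
pose K := \sum_i cp i + \sum_i lam i + \sum_j cm j + 1.
have sum_ge (I : finType) (F : I -> R) i : (forall i, 0 < F i) -> 0 <= F i <= \sum_i F i.
  move=> F0; rewrite ltW //= (bigD1 i) //= lerDl sumr_ge0 // => r _; exact: ltW.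
(* The minimum runs over the end values of all [A i] and of [B ord0]; the final 1 in [K] dominates
   the starting coefficient 1 of [b ord0]. *)
exists (Num.min (Num.min (cp i1) (lam i2)) (Num.min (cm ord0) 1)), K.
rewrite !lt_min cp0 lam0 cm0 ltr01; split=> // s s01.
have := sum_ge _ _ ord0 cp0; have := sum_ge _ _ ord0 lam0; have := sum_ge _ _ ord0 cm0.
move=> /andP[? ?] /andP[? ?] /andP[? ?].
have cmK j : 0 <= cm j <= K.
  have /andP[-> /=] := sum_ge _ _ j cm0; rewrite /K; lra.
split=> [i|j|].
- have /andP[? ?] := sum_ge _ _ i cp0; have /andP[? ?] := sum_ge _ _ i lam0.
  apply: affine_bounds => //; rewrite !ge_min.
    rewrite (min1 i isT) /= /K; lra.
  rewrite (min2 i isT) orbT /= /K; lra.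
- apply: affine_bounds => //.
  by case: (j == ord0); rewrite ?lexx ?ler01 /= /K; lra.
- rewrite eqxx.
  suff /andP[] : Num.min (Num.min (cp i1) (lam i2)) (Num.min (cm ord0) 1) <=
    s * cm ord0 + (1 - s) * 1 <= K by [].
  apply: affine_bounds => //; rewrite !ge_min lexx !orbT /=.
    by case/andP: (cmK ord0).
  rewrite /K; lra.
Qed.

End Homotopy.

Theorem theorem4p5 (R : realType) (n k m : nat)
  (a : 'I_k.+1 -> 'rV[int]_n) (b : 'I_m.+1 -> 'rV[int]_n)
  (ha : injective a) (hb : injective b) (hab : forall i j, a i != b j)
  (hfull : full_dim (cvx_hull (allpts R a b) predT))
  (hnonsep : nonseparable R a b)
  (hp : 'I_k.+1 -> int) (hm : 'I_m.+1 -> int)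
  (hlift_p : forall i, hp i = 0) (hlift_m : forall j, 0 < hm j)
  (cp : 'I_k.+1 -> R) (cm : 'I_m.+1 -> R)
  (hcp : forall i, 0 < cp i) (hcm : forall j, 0 < cm j)
  (lam : 'I_k.+1 -> R) (hlam : forall i, 0 < lam i) (hlam1 : \sum_i lam i = 1)
  (hlamb : \sum_i lam i *: pt R (a i) = pt R (b ord0)) :
  let chp : 'I_k.+1 -> R := lam in
  let chm : 'I_m.+1 -> R := fun j => if j == ord0 then 1 else 0 in
  let H (s t : R) (x : 'rV[R]_n) : 'rV[R]_(n.+1) :=
    crit a b (cstar (fun i => s * cp i + (1 - s) * chp i) hp t)
             (cstar (fun j => s * cm j + (1 - s) * chm j) hm t) x in
  H 0 1 (const_mx 1) = 0 /\
  exists (t : R -> R) (x : R -> 'rV[R]_n),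
    path_ok H t x /\
    (forall t' x', path_ok H t' x' ->
       forall s, 0 <= s <= 1 -> t' s = t s /\ x' s = x s) /\
    (forall tau : R,
       (0 < tau /\ exists y : 'rV[R]_n, (forall l, 0 < y ord0 l) /\
          crit a b (cstar cp hp tau) (cstar cm hm tau) y = 0)
       <-> tau = t 1).
Proof.
pose p (i : 'I_k.+1) := pt R (a i); pose q (j : 'I_m.+1) := pt R (b j).
(* The heights on the negative support are positive, so natural exponents suffice. *)
pose h j := `|hm j|%N; pose D := [set s : R | 0 <= s <= 1].
have h_gt0 j : (0 < h j)%N by rewrite absz_gt0 gt_eqF.
have support := nonseparable_support hnonsep.
have [eps eps_gt0 coercive] := nonseparable_coercive hnonsep.
have [kap [K [kap_gt0 pinch]]] := exists_pinch hcp hlam hcm.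
move=> chp chm H.
pose A (s : R) i := s * cp i + (1 - s) * chp i.
pose B (s : R) j := s * cm j + (1 - s) * chm j.
have cstar_m (c : 'I_m.+1 -> R) t : cstar c hm t = fun j => c j * t ^+ h j.
  by apply/funext => j; rewrite /cstar -[in LHS](gtz0_abs (hlift_m j)).
have cstar_p (c : 'I_k.+1 -> R) t : cstar c hp t = c.
  by apply/funext => i; rewrite /cstar hlift_p expr0z mulr1.
have HE s t u : H s t (map_mx (@expR R) u) = 0 <-> critical p q h (A s) (B s) t u.
  by rewrite /H cstar_m cstar_p; exact: crit_exp.
have uniq (s t : R) u (t' : R) u' : D s -> 0 < t -> 0 < t' -> critical p q h (A s) (B s) t u ->
    critical p q h (A s) (B s) t' u' -> t' = t /\ u' = u.
  move=> /pinch/(pinched_sign kap_gt0)[A0 B0 Bj0].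
  exact: (critical_unique hlam hlam1 hlamb support eps_gt0 coercive h_gt0).
(* At [u = 0] all exponentials are 1, and the equations become [hlam1] and the coordinates of
   [hlamb]. *)
have start : critical p q h (A 0) (B 0) 1 0.
  have A0 i : A 0 i = lam i by rewrite /A mul0r add0r subr0 mul1r.
  have B0 j : B 0 j = chm j by rewrite /B mul0r add0r subr0 mul1r.
  split=> [|l]; rewrite signomial_at0.
    under eq_bigr do rewrite A0.
    rewrite hlam1 (bigD1 ord0) //= B0 /chm eqxx expr1n mulr1 big1 ?addr0 ?subrr // => j j0.
    by rewrite B0 /chm (negPf j0) mul0r.
  under eq_bigr do rewrite A0.
  rewrite [X in _ - X](bigD1 ord0) //= B0 /chm eqxx expr1n mulr1.
  rewrite [X in _ - (_ + X)]big1 ?addr0 => [|j j0]; last first.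
    by rewrite B0 /chm (negPf j0) !mul0r.
  rewrite mul1r /q -hlamb summxE; apply/eqP; rewrite subr_eq0; apply/eqP.
  by under [RHS]eq_bigr do rewrite mxE.
have exp0 : map_mx (@expR R) (0 : 'rV[R]_n) = const_mx 1.
  by apply/rowP => l; rewrite !mxE expR0.
split; first by rewrite -exp0; exact/HE.
have /choice[g gP] : forall s, exists z : R * 'rV[R]_n,
    D s -> 0 < z.1 /\ critical p q h (A s) (B s) z.1 z.2.
  (* Outside the unit interval the value is an arbitrary default. *)
  move=> s; have [Ds|nDs] := pselect (D s); last by exists (0, 0).
  have [t [u [t0 sig0 sig_ge0]]] :=
    exists_min_zero hlam hlam1 eps_gt0 coercive h_gt0 kap_gt0 (pinch s Ds).
  (* A zero that is a global minimum is critical, by Fermat's rule in the coordinates [x]. *)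
  exists (t, u) => _; split=> //=; apply/crit_exp/crit_min_zero => [l||y y0].
  - by rewrite mxE expR_gt0.
  - by rewrite fpoly_exp.
  - by rewrite -(map_mx_lnK y0) fpoly_exp.
have D0 : D 0 by rewrite /D /= lexx ler01.
have D1 : D 1 by rewrite /D /= lexx ler01.
have cg : {within D, continuous g}.
  apply: (continuous_critical_path hlam hlam1 hlamb support eps_gt0 coercive h_gt0
            kap_gt0 _ _ pinch gP) => [i|j]; exact: continuous_affine.
(* Each [H s] has exactly one positive zero; this pins down the path pointwise and, at [s = 1], the
   set of admissible [tau]. *)
have HP (s t : R) (x : 'rV[R]_n) : D s -> 0 < t -> (forall l, 0 < x ord0 l) -> H s t x = 0 ->
    t = (g s).1 /\ x = map_mx (@expR R) (g s).2.
  move=> Ds t0 x0; rewrite -(map_mx_lnK x0) => /HE crx; have [gs0 gs] := gP s Ds.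
  by have [-> ->] := uniq _ _ _ _ _ Ds gs0 t0 gs crx.
exists (fun s => (g s).1), (fun s => map_mx (@expR R) (g s).2).
split; [|split].
- split.
    by move=> s; apply: (@continuous_comp (subspace D) _ _ g fst); [exact: cg|exact: cvg_fst].
  split.
    move=> s; apply: (@continuous_comp (subspace D) _ _ g (fun z => map_mx (@expR R) z.2)).
      exact: cg.
    apply: (@continuous_comp _ _ _ snd (map_mx (@expR R))); first exact: cvg_snd.
    by apply: continuous_map_mx; exact: continuous_expR.
  (* The chosen pair at [s = 0] is the explicit start, by uniqueness. *)
  have [g0 cg0] := gP 0 D0; have [g1 g2] := uniq _ _ _ _ _ D0 g0 ltr01 cg0 start.
  split; first by move=> s /gP[gs _]; split=> // l; rewrite mxE expR_gt0.
  by rewrite -g1 -g2 exp0; split=> //; split=> // s /gP[_ crs]; apply/HE.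
- move=> t' x' [_ [_ [pos [_ [_ zero]]]]] s Ds; have [t0 x0] := pos s Ds.
  exact: HP (zero s Ds).
move=> tau.
have H1 : forall y, H 1 tau y = crit a b (cstar cp hp tau) (cstar cm hm tau) y.
  move=> y; rewrite /H; congr (crit _ _ (cstar _ _ _) (cstar _ _ _) _);
    by apply/funext => r; rewrite subrr mul0r addr0 mul1r.
split=> [[tau0 [y [y0]]]|tauE].
  by rewrite -H1 => /(HP _ _ _ D1 tau0 y0)[].
have [g0 cg1] := gP 1 D1; split; first by rewrite tauE.
exists (map_mx (@expR R) (g 1).2).
split; first by move=> l; rewrite mxE expR_gt0.
by rewrite -H1 tauE; apply/HE.
Qed.
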